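(* Let $(Q,C)$ be a truncated quiver such that $Q$ is connected. Then there is a bijection $$\{S\subset\mathbb{Z}(Q,C)\mid S\text{ is a slice}\}/\tau^{\mathbb{Z}}\longrightarrow\{C'\subset Q_1\mid C'\sim C\}$$ induced by $S\mapsto C_S:=Q_1\setminus\pi(S_1)$. Moreover, for each slice $S$, $\pi$ induces an isomorphism $S\to Q_{C_S}$ of quivers.
   Context: A truncated quiver is a pair $(Q,C)$ of a quiver $Q$ (vertices $Q_0$, arrows $Q_1$) and an arbitrary subset $C\subset Q_1$. For $C'\subset Q_1$, $Q_{C'}$ is the subquiver of $Q$ with vertex set $Q_0$ and arrow set $Q_1\setminus C'$. The quiver $\mathbb{Z}(Q,C)$ has vertex set $Q_0\times\mathbb{Z}$ and, for every $\ell\in\mathbb{Z}$, an arrow $(a,\ell):(x,\ell)\to(y,\ell)$ for each arrow $a:x\to y$ in $Q_1\setminus C$ and an arrow $(a,\ell):(x,\ell)\to(y,\ell-1)$ for each arrow $a:x\to y$ in $C$. The morphism of quivers $\pi:\mathbb{Z}(Q,C)\to Q$ is $\pi(x,\ell)=x$, $\pi(a,\ell)=a$. The automorphism $\tau$ of $\mathbb{Z}(Q,C)$ is $\tau(x,\ell)=(x,\ell+1)$, $\tau(a,\ell)=(a,\ell+1)$. A slice is a full subquiver $S$ of $\mathbb{Z}(Q,C)$ (with vertex set $S_0$ and arrow set $S_1$) such that (i) any $\tau$-orbit in $\mathbb{Z}(Q,C)_0$ contains precisely one vertex belonging to $S$; (ii) for any arrow $x\to y$ in $\mathbb{Z}(Q,C)$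 with $x\in S_0$ we have $y\in S_0\cup\tau^{-1}S_0$. The group $\tau^{\mathbb{Z}}$ acts on the set of slices. A walk in $Q$ is a path in the quiver obtained by adding a formal inverse $a^{-1}$ in the opposite direction for each $a\in Q_1$. For $C\subset Q_1$ let $g_C(a)=1$ for $a\in C$, $g_C(a)=0$ for $a\in Q_1\setminus C$, $g_C(a^{-1})=-g_C(a)$, extended additively to walks. Subsets $C,C'\subset Q_1$ are compatible, written $C\sim C'$, if $g_C(p)=g_{C'}(p)$ for every cyclic walk $p$ in $Q$. *)

(* Defs.v *)
From HB Require Import structures.
From mathcomp Require Import all_boot all_order all_algebra.
From mathcomp Require Import boolp classical_sets functions.

Set Implicit Arguments.
Unset Strict Implicit.
Unset Printing Implicit Defensive.

Import Order.TTheory GRing.Theory Num.Theory.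
Local Open Scope classical_set_scope.
Local Open Scope ring_scope.

Record quiver := Quiver {
  vertex : Type;
  arrow : Type;
  src : arrow -> vertex;
  tgt : arrow -> vertex }.
Arguments src {q}.
Arguments tgt {q}.

Record qhom (G H : quiver) := QHom {
  hom_v : vertex G -> vertex H;
  hom_a : arrow G -> arrow H;
  hom_src : forall a, src (hom_a a) = hom_v (src a);
  hom_tgt : forall a, tgt (hom_a a) = hom_v (tgt a) }.

Definition is_qiso (G H : quiver) (f : qhom G H) : Prop :=
  exists g : qhom H G,
    [/\ cancel (hom_v f) (hom_v g), cancel (hom_v g) (hom_v f),
        cancel (hom_a f) (hom_a g) & cancel (hom_a g) (hom_a f)].

Record subquiver (G : quiver) := Subquiver {
  sub_v : set (vertex G);
  sub_a : set (arrow G);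
  sub_src : forall a, sub_a a -> sub_v (src a);
  sub_tgt : forall a, sub_a a -> sub_v (tgt a) }.

Definition is_full (G : quiver) (S : subquiver G) : Prop :=
  forall a, sub_v S (src a) -> sub_v S (tgt a) -> sub_a S a.

Definition quiver_of (G : quiver) (S : subquiver G) : quiver :=
  @Quiver (set_type (sub_v S)) (set_type (sub_a S))
    (fun a => exist _ (src (val a)) (mem_set (sub_src (set_mem (valP a)))))
    (fun a => exist _ (tgt (val a)) (mem_set (sub_tgt (set_mem (valP a))))).

Section SubImage.
Variables (G H : quiver) (f : qhom G H) (S : subquiver G).

Lemma sub_image_src a :
  (hom_a f @` sub_a S) a -> (hom_v f @` sub_v S) (src a).
Proof. by case=> b Sb <-; exists (src b); [exact: sub_src | rewrite hom_src]. Qed.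

Lemma sub_image_tgt a :
  (hom_a f @` sub_a S) a -> (hom_v f @` sub_v S) (tgt a).
Proof. by case=> b Sb <-; exists (tgt b); [exact: sub_tgt | rewrite hom_tgt]. Qed.

Definition sub_image : subquiver H := Subquiver sub_image_src sub_image_tgt.

End SubImage.

Definition induces_iso (G H : quiver) (f : qhom G H)
    (S : subquiver G) (T : subquiver H) : Prop :=
  exists h : qhom (quiver_of S) (quiver_of T),
    [/\ forall x, val (hom_v h x) = hom_v f (val x),
        forall a, val (hom_a h a) = hom_a f (val a) & is_qiso h].

(* The subquiver written Q_{C'}: all vertices, the arrows outside C'. *)
Definition cut_quiver (Q : quiver) (C' : set (arrow Q)) : subquiver Q :=
  @Subquiver Q setT (~` C') (fun _ _ => I) (fun _ _ => I).

Inductive qpath (G : quiver) : vertex G -> vertex G -> Type :=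
| qpath_nil x : qpath x x
| qpath_cons (a : arrow G) z : qpath (tgt a) z -> qpath (src a) z.

Fixpoint qpath_weight (G : quiver) (w : arrow G -> int) (x y : vertex G)
    (p : qpath x y) : int :=
  match p with
  | qpath_nil _ => 0
  | qpath_cons a _ p' => w a + qpath_weight w p'
  end.

(* inl a is the arrow a itself, inr a its formal inverse. *)
Definition double_quiver (Q : quiver) : quiver :=
  @Quiver (vertex Q) (arrow Q + arrow Q)
    (fun e => match e with inl a => src a | inr a => tgt a end)
    (fun e => match e with inl a => tgt a | inr a => src a end).

Definition walk (Q : quiver) (x y : vertex Q) : Type :=
  @qpath (double_quiver Q) x y.

(* The empty quiver counts as connected. *)
Definition connected_quiver (Q : quiver) : Prop :=
  forall x y : vertex Q, inhabited (walk x y).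

Definition grade_arrow (Q : quiver) (C : set (arrow Q)) (a : arrow Q) : int :=
  if a \in C then 1 else 0.

Definition grade_walk (Q : quiver) (C : set (arrow Q)) (x y : vertex Q)
    (p : walk x y) : int :=
  @qpath_weight (double_quiver Q)
    (fun e => match e with
              | inl a => grade_arrow C a
              | inr a => - grade_arrow C a
              end) x y p.

Definition compatible (Q : quiver) (C C' : set (arrow Q)) : Prop :=
  forall (x : vertex Q) (p : walk x x), grade_walk C p = grade_walk C' p.

Section ZQuiver.
Variables (Q : quiver) (C : set (arrow Q)).

Definition ZQ : quiver :=
  @Quiver (vertex Q * int)%type (arrow Q * int)%type
    (fun e => (src e.1, e.2))
    (fun e => (tgt e.1, if e.1 \in C then e.2 - 1 else e.2)).

Definition ZQ_pi : qhom ZQ Q :=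
  @QHom ZQ Q fst fst (fun _ => erefl) (fun _ => erefl).

Lemma tau_pow_tgt (n : int) (e : arrow ZQ) :
  @tgt ZQ (e.1, e.2 + n) = ((@tgt ZQ e).1, (@tgt ZQ e).2 + n).
Proof. by rewrite /=; case: ifP => // _; rewrite addrAC. Qed.

(* The n-th power of the automorphism tau = tau_pow 1, for n : int; see
   tau_powD and tau_pow0 below. *)
Definition tau_pow (n : int) : qhom ZQ ZQ :=
  @QHom ZQ ZQ (fun v => (v.1, v.2 + n)) (fun e => (e.1, e.2 + n))
    (fun _ => erefl) (tau_pow_tgt n).

Lemma tau_pow0 :
  (hom_v (tau_pow 0) =1 id) * (hom_a (tau_pow 0) =1 id).
Proof. by split=> -[x l]; rewrite /= addr0. Qed.

Lemma tau_powD (m n : int) :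
  (hom_v (tau_pow (m + n)) =1 hom_v (tau_pow m) \o hom_v (tau_pow n)) *
  (hom_a (tau_pow (m + n)) =1 hom_a (tau_pow m) \o hom_a (tau_pow n)).
Proof. by split=> -[x l]; rewrite /= addrCA addrC. Qed.

Definition tau_orbit_v (v : vertex ZQ) : set (vertex ZQ) :=
  range (fun n : int => hom_v (tau_pow n) v).

Definition is_slice (S : subquiver ZQ) : Prop :=
  [/\ is_full S,
      forall v : vertex ZQ, exists! w, (tau_orbit_v v `&` sub_v S) w
    & forall e : arrow ZQ, sub_v S (src e) ->
        (sub_v S `|` hom_v (tau_pow (-1)) @` sub_v S) (tgt e)].

Definition tau_orbit (S : subquiver ZQ) : set (subquiver ZQ) :=
  range (fun n : int => sub_image (tau_pow n) S).

(* The quotient of the set of slices by the group generated by tau. *)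
Definition slice_orbits : set (set (subquiver ZQ)) :=
  tau_orbit @` [set S | is_slice S].

(* The set written C_S. *)
Definition slice_cut (S : subquiver ZQ) : set (arrow Q) :=
  ~` (hom_a ZQ_pi @` sub_a S).

End ZQuiver.
Arguments ZQ {Q} C.
Arguments ZQ_pi {Q} C.
Arguments tau_pow {Q} C n.
Arguments slice_orbits {Q} C.

(* Main.v *)
Require Import Defs.
From mathcomp Require Import all_boot all_order all_algebra.
From mathcomp Require Import boolp classical_sets functions.
From mathcomp Require Import zify.

(** A slice meets every fibre of [ZQ C -> Q] in exactly one vertex, so its
    vertex set is the graph of a height function [h] on the vertices of [Q],
    and fullness makes [h] determine the slice.  The arrow of [ZQ C] above [a]
    that starts at height [h (src a)] ends at height
    [h (src a) - grade_arrow C a]; the last slice axiom says that this is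
    [h (tgt a)] or [h (tgt a) - 1].  The arrow lies in the slice in the first
    case, and [a] is cut in the second.  Hence, with [C'] the cut of the slice,

      h (tgt a) - h (src a) = grade_arrow C' a - grade_arrow C a

    for every arrow [a].  Conversely any [h] satisfying this equation defines
    a slice with cut [C'].  So slices with cut [C'] are the potentials of the
    function [grade_arrow C' - grade_arrow C] on arrows
    ([slice_height], [slice_of_height], [slice_cut_of_height]).

    The theorem then is the usual statement about potentials on a connected
    graph: one exists if and only if the function sums to zero on every closed
    walk, which here is compatibility ([compatible_potential],
    [potential_compatible]), and it is unique up to an additive constant
    ([potential_unique]).  Adding the constant [n] to the height function is
    the action of [tau ^ n] on slices ([tau_pow_of_height]).

    The isomorphism holds because the projection is injective on a graph,
    on vertices and on arrows, and its image is by construction the quiver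
    with the cut arrows removed ([induces_iso_of_bij]). *)

Set Implicit Arguments.
Unset Strict Implicit.
Unset Printing Implicit Defensive.

Import Order.TTheory GRing.Theory Num.Theory.
Local Open Scope classical_set_scope.
Local Open Scope ring_scope.

(** * Subquivers and induced isomorphisms *)

Lemma subquiver_eq (G : quiver) (S T : subquiver G) :
  sub_v S = sub_v T -> sub_a S = sub_a T -> S = T.
Proof.
case: S T => [Sv Sa Ss St] [Tv Ta Ts Tt] /= eqv eqa.
subst Tv Ta; congr Subquiver; exact: Prop_irrelevance.
Qed.

Lemma set_bij_restrict (X Y : Type) (A : set X) (B : set Y) (f : X -> Y) :
  set_bij A B f ->
  exists (k : set_type A -> set_type B) (g : set_type B -> set_type A),
    [/\ forall x, val (k x) = f (val x), cancel k g & cancel g k].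
Proof.
case=> fAB finj fsurj.
have /choice [k kE] (x : set_type A) : exists y : set_type B, val y = f (val x).
  have Bfx : B (f (val x)) by apply: fAB; exact: (set_mem (valP x)).
  by exists (exist _ (f (val x)) (mem_set Bfx)).
have kinj : injective k.
  move=> x y kxy; apply: val_inj; apply: finj; rewrite ?inE.
  - exact: (set_mem (valP x)).
  - exact: (set_mem (valP y)).
  - by rewrite -!kE kxy.
have /choice [g gK] (y : set_type B) : exists x, k x = y.
  have [x Ax fxy] := fsurj _ (set_mem (valP y)).
  by exists (exist _ x (mem_set Ax)); apply: val_inj; rewrite kE.
exists k, g; split=> // x; apply: kinj; exact: gK.
Qed.

(** The set-theoretic inverses automatically respect sources and targets. *)
Lemma induces_iso_of_bij (G H : quiver) (f : qhom G H)
    (S : subquiver G) (T : subquiver H) :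
  set_bij (sub_v S) (sub_v T) (hom_v f) ->
  set_bij (sub_a S) (sub_a T) (hom_a f) -> induces_iso f S T.
Proof.
move=> bijv bija.
have [kv [gv [kvE kvK gvK]]] := set_bij_restrict bijv.
have [ka [ga [kaE kaK gaK]]] := set_bij_restrict bija.
have ksrc (a : arrow (quiver_of S)) :
    @src (quiver_of T) (ka a) = kv (src a).
  by apply: val_inj; rewrite kvE /= kaE hom_src.
have ktgt (a : arrow (quiver_of S)) :
    @tgt (quiver_of T) (ka a) = kv (tgt a).
  by apply: val_inj; rewrite kvE /= kaE hom_tgt.
have gsrc (b : arrow (quiver_of T)) :
    @src (quiver_of S) (ga b) = gv (src b).
  by apply: (can_inj kvK); rewrite -ksrc gaK gvK.
have gtgt (b : arrow (quiver_of T)) :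
    @tgt (quiver_of S) (ga b) = gv (tgt b).
  by apply: (can_inj kvK); rewrite -ktgt gaK gvK.
by exists (QHom ksrc ktgt); split=> //; exists (QHom gsrc gtgt).
Qed.

(** * Potentials on a connected quiver *)

Fixpoint qpath_cat (G : quiver) (x y z : vertex G) (p : qpath x y) :
    qpath y z -> qpath x z :=
  match p in qpath x0 y0 return qpath y0 z -> qpath x0 z with
  | qpath_nil _ => id
  | qpath_cons a _ p' => fun q => qpath_cons (qpath_cat p' q)
  end.

Lemma qpath_weight_cat (G : quiver) (w : arrow G -> int) (x y z : vertex G)
    (p : qpath x y) (q : qpath y z) :
  qpath_weight w (qpath_cat p q) = qpath_weight w p + qpath_weight w q.
Proof. by elim: p q => [u|a u p IH] q /=; rewrite ?add0r // IH addrA. Qed.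

Lemma grade_walk_cat (Q : quiver) (C : set (arrow Q)) (x y z : vertex Q)
    (p : walk x y) (q : walk y z) :
  grade_walk C (qpath_cat p q : walk x z) = grade_walk C p + grade_walk C q.
Proof. exact: qpath_weight_cat. Qed.

Section Potentials.
Variables (Q : quiver) (C : set (arrow Q)).

Definition is_potential (C' : set (arrow Q)) (h : vertex Q -> int) : Prop :=
  forall a, h (tgt a) - h (src a) = grade_arrow C' a - grade_arrow C a.

Lemma potential_walk (C' : set (arrow Q)) h (x y : vertex Q) (p : walk x y) :
  is_potential C' h -> grade_walk C' p - grade_walk C p = h y - h x.
Proof.
move=> hP; rewrite /grade_walk.
elim: p => [u|[a|a] u p IH] /=; first by rewrite !subrr.
- by have := hP a; move: IH => /=; lia.
- by have := hP a; move: IH => /=; lia.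
Qed.

Lemma potential_compatible (C' : set (arrow Q)) h :
  is_potential C' h -> compatible C' C.
Proof.
by move=> hP x p; apply/eqP; rewrite -subr_eq0 (potential_walk p hP) subrr.
Qed.

(** Two potentials of the same function grow equally along every walk, so a
    walk from a fixed base vertex compares their values anywhere. *)
Lemma potential_unique (C' : set (arrow Q)) h k : connected_quiver Q ->
  is_potential C' h -> is_potential C' k ->
  exists n : int, forall x, k x = h x + n.
Proof.
move=> conQ hP kP.
have [[x0 _]|noQ] := pselect (exists x : vertex Q, True); last first.
  (* Without vertices every constant works. *)
  by exists 0 => x; case: noQ; exists x.
exists (k x0 - h x0) => x; have [p] := conQ x0 x.
by have := potential_walk p hP; rewrite (potential_walk p kP); lia.
Qed.

(** The potential at [x] is the weight of a chosen walk from a base vertex.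
    That it has the right increment along [a] follows by completing both the
    chosen walk to [tgt a] and the one through [a] to closed walks with the
    same return walk. *)
Lemma compatible_potential (C' : set (arrow Q)) : connected_quiver Q ->
  compatible C' C -> exists h, is_potential C' h.
Proof.
move=> conQ comp.
have [[x0 _]|noQ] := pselect (exists x : vertex Q, True); last first.
  by exists (fun=> 0) => a; case: noQ; exists (src a).
pose to x : walk x0 x := inhabited_witness (conQ x0 x).
exists (fun x => grade_walk C' (to x) - grade_walk C (to x)) => a.
have [back] := conQ (tgt a) x0.
pose around : walk (src a) x0 := @qpath_cons (double_quiver Q) (inl a) x0 back.
have aroundE D : grade_walk D around = grade_arrow D a + grade_walk D back.
  by [].
have := comp _ (qpath_cat (to (src a)) around : walk x0 x0).
have := comp _ (qpath_cat (to (tgt a)) back : walk x0 x0).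
by rewrite !grade_walk_cat !aroundE; lia.
Qed.

End Potentials.

(** * Slices as height functions *)

Section Heights.
Variables (Q : quiver) (C : set (arrow Q)).

Lemma ZQ_tgtE (e : arrow (ZQ C)) :
  tgt e = (tgt e.1, e.2 - grade_arrow C e.1) :> vertex (ZQ C).
Proof. by rewrite /= /grade_arrow; case: ifP; rewrite ?subr0. Qed.

Lemma grade_arrow1 (D : set (arrow Q)) a : D a -> grade_arrow D a = 1.
Proof. by move=> Da; rewrite /grade_arrow mem_set. Qed.

Lemma grade_arrow0 (D : set (arrow Q)) a : ~ D a -> grade_arrow D a = 0.
Proof. by move=> Da; rewrite /grade_arrow memNset. Qed.

Section OfHeight.
Variable h : vertex Q -> int.

Definition height_v : set (vertex (ZQ C)) := [set v | v.2 = h v.1].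

Definition height_a : set (arrow (ZQ C)) :=
  [set e | height_v (src e) /\ height_v (tgt e)].

Definition of_height : subquiver (ZQ C) :=
  @Subquiver (ZQ C) height_v height_a (fun _ => @proj1 _ _) (fun _ => @proj2 _ _).

Lemma height_aE a l :
  height_a (a, l) <-> l = h (src a) /\ l - grade_arrow C a = h (tgt a).
Proof. by rewrite /height_a /height_v [in X in X <-> _]/mkset ZQ_tgtE. Qed.

End OfHeight.

(** Since [grade_arrow C'] takes only the values 0 and 1, an arrow leaving the
    graph of [h] ends on the graph or one level below it. *)
Lemma slice_of_height (C' : set (arrow Q)) h :
  is_potential C C' h -> is_slice (of_height h).
Proof.
move=> hP; split=> //.
- move=> [x l]; exists (x, h x); split.
    by split=> //; exists (h x - l) => //=; congr pair; lia.
  by move=> [y m] [[n _ [<- _]]]; rewrite /= /height_v /= => ->.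
- move=> [a l] srcS; have {srcS} lE : l = h (src a) by [].
  rewrite ZQ_tgtE /= {}lE; have := hP a.
  have [C'a|C'a] := pselect (C' a).
  + rewrite (grade_arrow1 C'a) => ha; right.
    by exists (tgt a, h (tgt a)) => //=; congr pair; lia.
  + by rewrite (grade_arrow0 C'a) => ha; left; rewrite /= /height_v /=; lia.
Qed.

Lemma slice_cut_of_height (C' : set (arrow Q)) h :
  is_potential C C' h -> slice_cut (of_height h) = C'.
Proof.
move=> hP; apply/seteqP; split=> a.
- move=> cuta; apply: contrapT => C'a; apply: cuta.
  exists (a, h (src a)) => //; apply/height_aE; split=> //.
  by have := hP a; rewrite (grade_arrow0 C'a); lia.
- move=> C'a [[b l]] /height_aE [lE /eqP hb] /= ba; subst b l.
  by move: hb; have := hP a; rewrite (grade_arrow1 C'a); lia.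
Qed.

(** The height of [x] is the level at which the slice meets the tau-orbit of
    [(x, 0)].  An arrow [a] is cut exactly when the lift of [a] starting in the
    slice ends outside it, hence one level below it, which is the potential
    equation. *)
Lemma slice_height (S : subquiver (ZQ C)) : is_slice S ->
  exists2 h, S = of_height h & is_potential C (slice_cut S) h.
Proof.
case=> fullS orbS stepS.
have /choice [h hP] (x : vertex Q) :
    exists l, forall m, sub_v S (x, m) <-> m = l.
  have [[y l] [[[n _ [<- _]] Sxl] uniq]] := orbS (x, 0).
  exists l => m; split=> [Sxm|-> //].
  have [] // : (x, l) = (x, m) :> vertex (ZQ C).
  by apply: uniq; split=> //; exists m => //=; rewrite add0r.
have SE : S = of_height h.
  have Sv : sub_v S = height_v h.
    by apply/seteqP; split=> [] [x l] /hP.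
  apply: subquiver_eq => //; apply/seteqP; split=> e.
    by move=> Se; split; rewrite -Sv; [exact: sub_src|exact: sub_tgt].
  by case=> es et; apply: fullS; rewrite Sv.
exists h => // a.
have Ssrc : sub_v S (@src (ZQ C) (a, h (src a))) by apply/hP.
have := stepS _ Ssrc; rewrite ZQ_tgtE /=.
have cutE : slice_cut S a <-> h (src a) - grade_arrow C a <> h (tgt a).
  rewrite /slice_cut SE; split.
    by move=> cuta ha; apply: cuta; exists (a, h (src a)) => //; apply/height_aE.
  by move=> nha [[b l] /height_aE [lE hb]] /= ba; subst b l.
case=> [/hP ha|[[y l] /hP lE [yE ha]]].
- by rewrite (@grade_arrow0 (slice_cut S)) => [|/cutE //]; lia.
- subst y; rewrite (@grade_arrow1 (slice_cut S)); first by lia.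
  by apply/cutE; lia.
Qed.

Lemma slice_cut_compatible (S : subquiver (ZQ C)) :
  is_slice S -> compatible (slice_cut S) C.
Proof. by move=> /slice_height [h _ /potential_compatible]. Qed.

Lemma slice_induces_iso (S : subquiver (ZQ C)) :
  is_slice S -> induces_iso (ZQ_pi C) S (cut_quiver (slice_cut S)).
Proof.
move=> /slice_height [h SE _]; apply: induces_iso_of_bij; split.
- by [].
- move=> [x l] [y m]; rewrite !inE SE /= /height_v /= => -> -> -> //.
- by move=> x _; exists (x, h x) => //; rewrite SE.
- by move=> e Se; apply; exists e.
- move=> [a l] [b m]; rewrite !inE SE /= => /height_aE [-> _] /height_aE [-> _].
  by move=> ->.
- by move=> a /contrapT.
Qed.

(** * The action of tau *)

Lemma tau_pow_of_height (n : int) h :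
  sub_image (tau_pow C n) (of_height h) = of_height (fun x => h x + n).
Proof.
apply: subquiver_eq; apply/seteqP; split.
- by move=> _ [[x l] + <-]; rewrite /= /height_v /= => ->.
- by move=> [x l]; rewrite /= /height_v /= => ->; exists (x, h x).
- by move=> _ [[a l] /height_aE [l1 l2] <-]; apply/height_aE => /=; lia.
- move=> [a l] /height_aE [l1 l2]; exists (a, h (src a)); last by rewrite l1.
  by apply/height_aE; lia.
Qed.

Lemma sub_image_tau_powD (m n : int) (S : subquiver (ZQ C)) :
  sub_image (tau_pow C m) (sub_image (tau_pow C n) S) =
  sub_image (tau_pow C (m + n)) S.
Proof.
by apply: subquiver_eq; rewrite /= image_comp; apply: eq_imagel => x _;
  rewrite /= -addrA (addrC n).
Qed.

Lemma tau_orbit_tau_pow (n : int) (S : subquiver (ZQ C)) :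
  tau_orbit (sub_image (tau_pow C n) S) = tau_orbit S.
Proof.
apply/seteqP; split=> _ [m _ <-].
  by exists (m + n) => //; rewrite sub_image_tau_powD.
by exists (m - n) => //; rewrite sub_image_tau_powD subrK.
Qed.

Lemma slice_cut_tau_pow (n : int) (S : subquiver (ZQ C)) :
  slice_cut (sub_image (tau_pow C n) S) = slice_cut S.
Proof. by rewrite /slice_cut /= image_comp. Qed.

Lemma tau_orbit_refl (S : subquiver (ZQ C)) : tau_orbit S S.
Proof.
exists 0 => //; have [v0 a0] := tau_pow0 C.
by apply: subquiver_eq; rewrite -[RHS]image_id; apply: eq_imagel => x _;
  rewrite ?v0 ?a0.
Qed.

(** Equal cuts give potentials of the same function, which differ by a constant
    and so define slices that differ by a power of tau. *)
Lemma slice_cut_inj (S T : subquiver (ZQ C)) : connected_quiver Q ->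
  is_slice S -> is_slice T -> slice_cut S = slice_cut T ->
  tau_orbit S = tau_orbit T.
Proof.
move=> conQ /slice_height [h SE hP] /slice_height [k TE kP] cutE.
rewrite -cutE in kP.
have [n kE] := potential_unique conQ hP kP.
suff -> : T = sub_image (tau_pow C n) S by rewrite tau_orbit_tau_pow.
by rewrite TE SE tau_pow_of_height; congr of_height; apply: funext.
Qed.

(** The image of an orbit of subquivers under [slice_cut] is a singleton; the
    union of that singleton is its element, which avoids choosing a
    representative. *)
Definition orbit_cut (O : set (subquiver (ZQ C))) : set (arrow Q) :=
  \bigcup_(S in O) slice_cut S.

Lemma orbit_cutE (S : subquiver (ZQ C)) :
  orbit_cut (tau_orbit S) = slice_cut S.
Proof.
apply/seteqP; split=> a.
  by case=> _ [n _ <-]; rewrite slice_cut_tau_pow.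
by move=> cuta; exists S => //; exact: tau_orbit_refl.
Qed.

End Heights.

(** * The bijection *)

Theorem theorem6p8 (Q : quiver) (C : set (arrow Q)) (hQ : connected_quiver Q) :
  (exists phi : set (subquiver (ZQ C)) -> set (arrow Q),
     set_bij (slice_orbits C) [set C' : set (arrow Q) | compatible C' C] phi
     /\ forall S : subquiver (ZQ C), is_slice S ->
          phi (tau_orbit S) = slice_cut S)
  /\ forall S : subquiver (ZQ C), is_slice S ->
       induces_iso (ZQ_pi C) S (cut_quiver (slice_cut S)).
Proof.
split; last exact: slice_induces_iso.
exists (@orbit_cut Q C); split; last by move=> S _; exact: orbit_cutE.
split.
- move=> _ [S sliceS <-]; rewrite orbit_cutE; exact: slice_cut_compatible.
- move=> O O'; rewrite !inE => -[S sliceS <-] [T sliceT <-].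
  by rewrite !orbit_cutE; exact: slice_cut_inj.
- move=> C' /(compatible_potential hQ) [h hP].
  exists (tau_orbit (of_height C h)).
    by exists (of_height C h) => //; exact: slice_of_height hP.
  by rewrite orbit_cutE; exact: slice_cut_of_height.
Qed.
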